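(* Let $X$ be a strictly convex Banach space and let $A \subset X$ be a nontrivial bounded centerable M-compact subset containing its Chebyshev center $c_A$. Then $A$ is CCNF.
   Context: A Banach space $X$ is strictly convex if its unit sphere contains no nontrivial line segment. For a nonempty bounded set $A \subseteq X$ and $x \in X$, put $r(x,A) = \sup_{a \in A}\|x-a\|$ and $F(x,A) = \{a \in A : \|x-a\| = r(x,A)\}$, and let $\mathrm{Far}\,A = \bigcup_{x \in X} F(x,A)$. The Chebyshev radius of $A$ is $r(A) = \inf_{x \in X} r(x,A)$; a point $c \in X$ with $r(c,A) = r(A)$ is called a Chebyshev center of $A$; ''$A$ contains its Chebyshev center'' means that some Chebyshev center of $A$ belongs to $A$. A set is nontrivial if it has at least two elements. $A$ is a CCF set if some Chebyshev center of $A$ belongs to $\mathrm{Far}\,A$, and a CCNF set otherwise. $A$ is centerable if $r(A) = \frac12 \mathrm{diam}(A)$, where $\mathrm{diam}(A) = \sup_{a_1,a_2 \in A}\|a_1-a_2\|$. A sequence $\{a_n\}$ in $A$ is maximizing if for some $x \in X$ one has $\|x-a_n\| \to r(x,A)$; $A$ is M-compact if every maximizing sequence in $A$ has a subsequence converging to an element of $A$. *)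

(* Defs.v *)
From HB Require Import structures.
From mathcomp Require Import all_boot all_order all_algebra.
From mathcomp Require Import all_classical all_reals all_analysis.

Set Implicit Arguments.
Unset Strict Implicit.
Unset Printing Implicit Defensive.

Import Order.TTheory GRing.Theory Num.Theory.
Import numFieldNormedType.Exports.

Local Open Scope classical_set_scope.
Local Open Scope ring_scope.

Definition unit_sphere (R : realType) (X : normedModType R) : set X :=
  [set x | `|x| = 1].

Definition segment (R : realType) (X : normedModType R) (x y : X) : set X :=
  [set (1 - t) *: x + t *: y | t in `[0 : R, 1]].

Definition strictly_convex (R : realType) (X : normedModType R) : Prop :=
  forall x y : X, x != y -> ~ (segment x y `<=` @unit_sphere R X).

Definition nontrivial_set (T : Type) (A : set T) : Prop :=
  exists a b, [/\ A a, A b & a <> b].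

(* [sup], [inf] below are total on [set R] (value 0 on sets without a finite
   supremum/infimum): [farthest_dist], [chebyshev_radius] and [diameter] have
   their usual meaning only for nonempty bounded [A]. *)
Definition farthest_dist (R : realType) (X : normedModType R)
    (x : X) (A : set X) : R :=
  sup [set `|x - a| | a in A].

Definition farthest_points (R : realType) (X : normedModType R)
    (x : X) (A : set X) : set X :=
  [set a | A a /\ `|x - a| = farthest_dist x A].

Definition Far (R : realType) (X : normedModType R) (A : set X) : set X :=
  \bigcup_(x in [set: X]) farthest_points x A.

Definition chebyshev_radius (R : realType) (X : normedModType R)
    (A : set X) : R :=
  inf [set farthest_dist x A | x in [set: X]].

Definition chebyshev_center (R : realType) (X : normedModType R)
    (A : set X) (c : X) : Prop :=
  farthest_dist c A = chebyshev_radius A.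

Definition CCF (R : realType) (X : normedModType R) (A : set X) : Prop :=
  exists c, chebyshev_center A c /\ Far A c.

Definition CCNF (R : realType) (X : normedModType R) (A : set X) : Prop :=
  ~ CCF A.

Definition diameter (R : realType) (X : normedModType R) (A : set X) : R :=
  sup [set `|a1 - a2| | a1 in A & a2 in A].

Definition centerable (R : realType) (X : normedModType R)
    (A : set X) : Prop :=
  chebyshev_radius A = 2^-1 * diameter A.

Definition maximizing (R : realType) (X : normedModType R)
    (A : set X) (a : nat -> X) : Prop :=
  (forall n, A (a n)) /\
  exists x : X, `|x - a n| @[n --> \oo] --> farthest_dist x A.

(* [increasing_seq] is strict monotonicity, so [a \o f] is a subsequence. *)
Definition M_compact (R : realType) (X : normedModType R)
    (A : set X) : Prop :=
  forall a : nat -> X, maximizing A a ->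
    exists f : nat -> nat, increasing_seq f /\
      exists2 l : X, A l & a (f n) @[n --> \oo] --> l.

(* Main.v *)
(** Take [a_n, b_n] in [A] with [|a_n - b_n|] tending to the diameter [2 r(A)].
    As both points lie within [r(A)] of a Chebyshev center [c], both sequences
    are maximizing for [c], so by M-compactness there are [a, b] in [A] with
    [|a - b| = 2 r(A)]; by strict convexity [c] is their midpoint.  If [c] were
    farthest from some [x], then [x - c] would be the midpoint of [x - a] and
    [x - b], which are no longer than [x - c]; strict convexity gives [a = b]. *)

Require Import Defs.
From mathcomp Require Import all_boot all_order all_algebra.
From mathcomp Require Import all_classical all_reals all_analysis.
From mathcomp Require Import lra.

Set Implicit Arguments.
Unset Strict Implicit.
Unset Printing Implicit Defensive.

Import Order.TTheory GRing.Theory Num.Theory.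
Import numFieldNormedType.Exports.

Local Open Scope classical_set_scope.
Local Open Scope ring_scope.

(** If [u] and [v] differed, the whole segment joining [r^-1 *: u] to [r^-1 *: v] would lie on the
    unit sphere. *)
Lemma strictly_convex_eq (R : realType) (X : normedModType R) (u v : X)
    (r : R) :
  strictly_convex X -> `|u| <= r -> `|v| <= r -> 2 * r <= `|u + v| -> u = v.
Proof.
move=> sc ur vr uvr; apply/eqP/negPn/negP => uv.
have r0 : 0 < r.
  rewrite lt_neqAle (le_trans _ ur)// andbT; apply: contra uv => /eqP r0.
  move: ur vr; rewrite -r0 !normr_le0 => /eqP -> /eqP ->; exact: eqxx.
have rV : `|r^-1| = r^-1 by rewrite ger0_norm// invr_ge0 ltW.
apply: (sc (r^-1 *: u) (r^-1 *: v)).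
  apply: contra uv => /eqP /(congr1 (fun w => r *: w)).
  by rewrite !scalerA divff ?gt_eqF// !scale1r => ->.
move=> z [t /=]; rewrite in_itv/= => /andP[t0 t1] <-.
rewrite /unit_sphere/=.
have comb (s : R) : 0 <= s -> s <= 1 -> `|(1 - s) *: u + s *: v| <= r.
  move=> s0 s1; apply: le_trans (ler_normD _ _) _; rewrite !normrZ.
  rewrite (ger0_norm s0) ger0_norm ?subr_ge0//.
  have := ler_wpM2l s0 vr.
  have /ler_wpM2l/(_ _ _ ur) : 0 <= 1 - s by rewrite subr_ge0.
  by lra.
(* The points with parameters [t] and [1 - t] add up to [u + v]. Both have norm at most [r], so a
   sum of norm at least [2 * r] forces equality. *)
have eqr : `|(1 - t) *: u + t *: v| = r.
  apply/eqP; rewrite eq_le comb//=.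
  have t'0 : 0 <= 1 - t by rewrite subr_ge0.
  have t'1 : 1 - t <= 1 by lra.
  have := comb _ t'0 t'1; rewrite subKr.
  have : u + v = ((1 - t) *: u + t *: v) + (t *: u + (1 - t) *: v).
    by rewrite addrACA -!scalerDl [t + _]addrC subrK !scale1r.
  move: uvr => /[swap] -> uvr.
  have := ler_normD ((1 - t) *: u + t *: v) (t *: u + (1 - t) *: v).
  by lra.
rewrite !scalerA ![_ * r^-1]mulrC -!scalerA -scalerDr normrZ rV eqr.
by rewrite mulVf// gt_eqF.
Qed.

Lemma increasing_seq_cvg_infty (f : nat -> nat) :
  increasing_seq f -> f n @[n --> \oo] --> \oo.
Proof.
move=> /increasing_seqP fincr.
have le_f n : (n <= f n)%N by elim: n => // n IH; exact: leq_ltn_trans IH (fincr n).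
apply/cvgnyPge => m; near=> n; apply: leq_trans (le_f n).
by near: n; exact: nbhs_infty_ge.
Unshelve. all: by end_near. Qed.

Section bounded_set.
Variables (R : realType) (X : normedModType R) (A : set X).
Hypothesis Abnd : bounded_set A.

Lemma bounded_set_dist (x : X) :
  exists M, forall a, A a -> `|x - a| <= M.
Proof.
have /pinfty_ex_gt0[M _ AM] := Abnd.
exists (`|x| + M) => a Aa.
by apply: le_trans (ler_normB _ _) _; rewrite lerD2l; exact: AM.
Qed.

Lemma dist_le_farthest (x a : X) : A a -> `|x - a| <= farthest_dist x A.
Proof.
move=> Aa; apply: ub_le_sup; last by exists a.
by have [M AM] := bounded_set_dist x; exists M => _ [b Ab <-]; exact: AM.
Qed.

Lemma has_ubound_dist : has_ubound [set `|a1 - a2| | a1 in A & a2 in A].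
Proof.
have [M AM] := bounded_set_dist 0.
exists (M + M) => _ [a Aa [b Ab <-]].
apply: le_trans (ler_normB _ _) _.
by rewrite -[a]opprK normrN -(sub0r a) -(normrN b) -(sub0r b) lerD ?AM.
Qed.

Lemma dist_le_diameter (a b : X) : A a -> A b -> `|a - b| <= diameter A.
Proof.
by move=> Aa Ab; apply: (ub_le_sup has_ubound_dist); exists a => //; exists b.
Qed.

Lemma diameter_attained (c : X) : A !=set0 -> M_compact A ->
    2 * farthest_dist c A = diameter A ->
  exists a b, [/\ A a, A b & `|a - b| = diameter A].
Proof.
move=> [p Ap] Mc cdiam; set r := farthest_dist c A in cdiam.
(* [harmonic n] is a positive tolerance tending to 0. *)
have /choice[w wP] (n : nat) : exists q : X * X,
    [/\ A q.1, A q.2 & diameter A - harmonic n < `|q.1 - q.2|].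
  have [||_ [a Aa [b Ab <-]] lt] := @sup_adherent _
    [set `|a1 - a2| | a1 in A & a2 in A] (harmonic n).
  - exact: harmonic_gt0.
  - split; last exact: has_ubound_dist.
    by exists `|p - p|; exists p => //; exists p.
  - by exists (a, b).
have lim (l : R) : l - harmonic n @[n --> \oo] --> l.
  rewrite -[X in _ --> X]subr0.
  by apply: cvgB; [exact: cvg_cst|exact: cvg_harmonic].
(* Triangle inequality through [c]: the two distances to [c] add up to more than
   [2 * r - harmonic n], and neither exceeds [r]. *)
have near_r n : r - harmonic n <= `|c - (w n).1| <= r /\
                r - harmonic n <= `|c - (w n).2| <= r.
  have [Aa Ab lt] := wP n.
  have la := dist_le_farthest c Aa; have lb := dist_le_farthest c Ab.
  have := ler_distD c (w n).1 (w n).2.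
  rewrite (distrC _ c); rewrite -cdiam -/r in la lb lt *.
  move=> tri; split; apply/andP; split => //; lra.
have cvg1 : `|c - (w n).1| @[n --> \oo] --> r.
  apply: (squeeze_cvgr _ (lim r) (cvg_cst r)).
  by near=> n; exact: (near_r n).1.
have cvg2 : `|c - (w n).2| @[n --> \oo] --> r.
  apply: (squeeze_cvgr _ (lim r) (cvg_cst r)).
  by near=> n; exact: (near_r n).2.
have cvgd : `|(w n).1 - (w n).2| @[n --> \oo] --> diameter A.
  apply: (squeeze_cvgr _ (lim _) (cvg_cst (diameter A))).
  near=> n; have [Aa Ab lt] := wP n.
  by rewrite (ltW lt)/= dist_le_diameter.
have [|f [/increasing_seq_cvg_infty fy [a Aa fa]]] := Mc (fun n => (w n).1).
  by split=> [n|]; [have [] := wP n|exists c].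
(* The second extraction is made along [f], so that both components converge along [f \o g]. *)
have [|g [/increasing_seq_cvg_infty gy [b Ab gb]]] := Mc (fun n => (w (f n)).2).
  by split=> [n|]; [have [] := wP (f n)|exists c; exact: cvg_comp fy cvg2].
exists a, b; split => //.
have ab : `|(w (f (g n))).1 - (w (f (g n))).2| @[n --> \oo] --> `|a - b|.
  by apply: cvg_norm; apply: cvgB => //; exact: cvg_comp gy fa.
have dd : `|(w (f (g n))).1 - (w (f (g n))).2| @[n --> \oo] --> diameter A.
  exact: cvg_comp (cvg_comp _ _ gy fy) cvgd.
exact: cvg_unique ab dd.
Unshelve. all: by end_near. Qed.

End bounded_set.

Theorem theorem2p15 (R : realType) (X : completeNormedModType R)
    (A : set X) (cA : X) :
  strictly_convex X ->
  nontrivial_set A -> bounded_set A -> centerable A -> M_compact A ->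
  chebyshev_center A cA -> A cA ->
  CCNF A.
Proof.
move=> sc [p [q [Ap Aq pq]]] Abnd Acent Mc _ _ [c [cc [x _ [Ac cx]]]].
have cdiam : 2 * farthest_dist c A = diameter A.
  by rewrite cc Acent mulrA divff ?mul1r// pnatr_eq0.
have [|a [b [Aa Ab ab]]] := diameter_attained Abnd _ Mc cdiam; first by exists p.
(* Both vectors have norm at most the radius, while their sum [b - a] has norm twice the radius. *)
have mid : c - a = b - c.
  apply: (strictly_convex_eq sc (r := farthest_dist c A)).
  - exact: dist_le_farthest.
  - by rewrite distrC; exact: dist_le_farthest.
  - by rewrite cdiam addrC addrA subrK -ab distrC.
have : x - a = x - b.
  apply: (strictly_convex_eq sc (r := `|x - c|)).
  - by rewrite cx; exact: dist_le_farthest.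
  - by rewrite cx; exact: dist_le_farthest.
  (* By [mid], [c] is the midpoint of [a] and [b]. *)
  - have -> : x - a + (x - b) = 2 *: (x - c).
      have -> : x - a = x - c + (b - c) by rewrite -mid addrA subrK.
      by rewrite scaler_nat mulr2n -addrA [b - c + _]addrC [x - b + _]addrA subrK.
    by rewrite normrZ ger0_norm.
move/addrI/oppr_inj => eab.
(* With [a = b] the diameter is 0, which makes [p] and [q] coincide. *)
apply/pq/eqP; rewrite -subr_eq0 -normr_le0.
by apply: le_trans (dist_le_diameter Abnd Ap Aq) _; rewrite -ab eab subrr normr0.
Qed.
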